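(* Let $p>1$, $a>0$, $q>0$ satisfy $$M:=\frac{p-1}{2}a-\frac{q}{2}+1>0,$$ and let $B>0$. Then there exists a positive constant $C_0=C_0(p,a,q,B)$, depending only on $p,a,q,B$, such that the following holds. Let $A,R,T_0>0$ be constants, let $0<T\le\infty$, and let $F\in C^2([0,T))$ be a real-valued function satisfying $$F(t)\ge A t^a\quad\text{for } T_0\le t<T,$$ $$F''(t)\ge B(t+R)^{-q}|F(t)|^p\quad\text{for } 0\le t<T,$$ $$F(0)>0,\qquad F'(0)=0,$$ and suppose in addition that there is a time $t_0\in(0,T)$ such that $$F(t_0)\ge 2F(0).$$ If $$T_2:=\max\{T_0,t_0,R\}\ge C_0A^{-(p-1)/(2M)},$$ then $$T<2^{2/M}T_2.$$
   Context: The inequality $F(t)\ge At^a$ is assumed at those times $t\ge T_0$ which lie in the interval $[0,T)$ on which $F$ is defined. $F\in C^2([0,T))$ includes one-sided derivatives at $t=0$. *)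

(* Defs.v *)
From Stdlib Require Import Reals.
From Coquelicot Require Import Coquelicot.
Open Scope R_scope.

(* The interval [0, T), where [T] may be [p_infty]. *)
Definition Ico0 (T : Rbar) (t : R) : Prop := 0 <= t /\ Rbar_lt t T.

(* [f] is twice continuously differentiable on [D], with first derivative [f1]
    and second derivative [f2] there.  [D_in] and [continue_in] take limits
    along [D] only, so on [Ico0 T] the derivatives at [0] are one-sided;
    the values of [f], [f1], [f2] outside [D] are irrelevant. *)
Definition C2_on (D : R -> Prop) (f f1 f2 : R -> R) : Prop :=
  forall t, D t -> D_in f f1 D t /\ D_in f1 f2 D t /\ continue_in f2 D t.

(* [|x|^p] for [p > 0].  [Rpower 0 p] is [1] in the standard library, hence
    the separate case at [x = 0]. *)
Definition abs_pow (x p : R) : R :=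
  if Req_dec_T x 0 then 0 else Rpower (Rabs x) p.

(* Main.v *)
Require Import Defs.
From Stdlib Require Import Reals Lra.
From Coquelicot Require Import Coquelicot.
Open Scope R_scope.

(** Since [F' F'' >= B (t+R)^(-q) F^p F'], the energy
    [F'^2/2 - B/(p+1) (t+R)^(-q) (F^(p+1) - F(0)^(p+1))] is nondecreasing, hence
    nonnegative.  Once [F >= 2 F(0)] and [t >= R] this reads
    [F' >= k t^(-q/2) F^((p+1)/2)].  Trading part of the power of [F] for
    [A t^a] leaves [F' F^(-1-d) >= k A^(r-d) t^(m-1)] with [r = (p-1)/2],
    [m = M - a d > 0] and a small [d > 0], and integrating from [T2] bounds
    [A^r T2^M] by a constant as soon as the solution lives up to a fixed
    multiple [mu T2] with [mu > 1]. *)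

(** * Monotonicity from the derivative, and calculus of real powers *)

(** Continuity at [a] replaces differentiability there, so that the lemma applies from time 0, where
    the derivatives are one-sided. *)
Lemma le_of_derive_nonneg (f df : R -> R) (a b : R) :
  a <= b ->
  continuity_pt f a ->
  (forall t, a < t <= b -> is_derive f t (df t)) ->
  (forall t, a < t <= b -> 0 <= df t) ->
  f a <= f b.
Proof.
intros Hab Hc Hd Hp.
(* [MVT_gen] only locates the mean point in the closed interval. *)
destruct (MVT_gen f a b (fun t => Rmax 0 (df t))) as [c [_ Hc2]].
- intros t; rewrite Rmin_left, Rmax_right by assumption; intros Ht.
  rewrite Rmax_right by (apply Hp; lra). apply Hd; lra.
- intros t; rewrite Rmin_left, Rmax_right by assumption; intros Ht.
  destruct (Req_dec t a) as [-> | Hta]; [exact Hc|].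
  apply derivable_continuous_pt; exists (df t).
  apply is_derive_Reals, Hd; lra.
- assert (0 <= Rmax 0 (df c) * (b - a)).
  { apply Rmult_le_pos; [apply Rmax_l | lra]. }
  lra.
Qed.

Lemma Rpower_gt0 (x y : R) : 0 < Rpower x y.
Proof. apply exp_pos. Qed.

Lemma continuity_pt_Rpower (f : R -> R) (b t : R) :
  0 < f t -> continuity_pt f t -> continuity_pt (fun s => Rpower (f s) b) t.
Proof.
intros Hf Hc.
apply (continuity_pt_comp f (fun x => Rpower x b)); [exact Hc|].
apply derivable_continuous_pt; eexists; apply derivable_pt_lim_power, Hf.
Qed.

Lemma is_derive_Rpower_comp (f : R -> R) (b t df : R) :
  0 < f t -> is_derive f t df ->
  is_derive (fun s => Rpower (f s) b) t (b * Rpower (f t) (b - 1) * df).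
Proof.
intros Hf Hd.
replace (b * Rpower (f t) (b - 1) * df) with (scal df (b * Rpower (f t) (b - 1)))
  by (unfold scal; simpl; unfold mult; simpl; ring).
apply (is_derive_comp (fun x => Rpower x b) f); [|exact Hd].
apply is_derive_Reals, derivable_pt_lim_power, Hf.
Qed.

(** * Energy inequality and the first-order blow-up argument *)

(** The difference [E] of the two sides vanishes at 0 because [g 0 = 0]. Its derivative is a sum of
    two nonnegative terms: [g] times the slack in the bound on [h], and the gain from the decreasing
    weight [Rpower (t + R0) (- q)]. *)
Lemma energy_bound (p q B R0 S : R) (f g h : R -> R) :
  1 < p -> 0 < q -> 0 < B -> 0 < R0 ->
  continuity_pt f 0 -> continuity_pt g 0 ->
  (forall t, 0 < t <= S -> is_derive f t (g t)) ->
  (forall t, 0 < t <= S -> is_derive g t (h t)) ->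
  0 < f 0 -> g 0 = 0 ->
  (forall t, 0 < t <= S -> 0 <= g t) ->
  (forall t, 0 <= t <= S -> f 0 <= f t) ->
  (forall t, 0 < t <= S -> B * Rpower (t + R0) (- q) * Rpower (f t) p <= h t) ->
  forall t, 0 <= t <= S ->
  B / (p + 1) * Rpower (t + R0) (- q) * (Rpower (f t) (p + 1) - Rpower (f 0) (p + 1))
    <= g t * g t / 2.
Proof.
intros Hp Hq HB HR Cf Cg Df Dg Hf0 Hg0 Hg Hf Hh t Ht.
pose (V := fun s => Rpower (f s) (p + 1) - Rpower (f 0) (p + 1)).
pose (E := fun s => g s * g s / 2 - B / (p + 1) * Rpower (s + R0) (- q) * V s).
enough (E 0 <= E t) by (unfold E, V in H; rewrite Hg0 in H; lra).
pose (E1 := fun s => g s * (h s - B * Rpower (s + R0) (- q) * Rpower (f s) p)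
   + B / (p + 1) * (q * Rpower (s + R0) (- q - 1)) * V s).
apply (le_of_derive_nonneg E E1); [lra | | |].
- unfold E, V.
  apply continuity_pt_minus.
  + apply continuity_pt_mult; [apply continuity_pt_mult; assumption|].
    apply continuity_pt_const; intros ? ?; reflexivity.
  + apply continuity_pt_mult.
    * apply continuity_pt_mult; [apply continuity_pt_const; intros ? ?; reflexivity|].
      apply (continuity_pt_Rpower (fun s => s + R0)); [lra|].
      apply continuity_pt_plus; [apply continuity_pt_id|].
      apply continuity_pt_const; intros ? ?; reflexivity.
    * apply continuity_pt_minus; [apply continuity_pt_Rpower; assumption|].
      apply continuity_pt_const; intros ? ?; reflexivity.
- intros s Hs.
  assert (Hfs : 0 < f s) by (generalize (Hf s ltac:(lra)); lra).
  assert (HdR : is_derive (fun s => Rpower (s + R0) (- q)) s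
            (- q * Rpower (s + R0) (- q - 1) * 1)).
  { apply (is_derive_Rpower_comp (fun s => s + R0)); [lra|].
    auto_derive; [exact I | ring]. }
  assert (HdF := is_derive_Rpower_comp f (p + 1) s (g s) Hfs (Df s ltac:(lra))).
  replace (p + 1 - 1) with p in HdF by ring.
  assert (HdG := Dg s ltac:(lra)).
  unfold E, V.
  (* Naming the two powers makes [auto_derive] treat them as abstract differentiable functions, with
     the derivatives [HdR] and [HdF]. *)
  set (u := fun s => Rpower (s + R0) (- q)) in *.
  set (v := fun s => Rpower (f s) (p + 1)) in *.
  change (is_derive (fun s => g s * g s / 2 - B / (p + 1) * u s * (v s - v 0)) s (E1 s)).
  auto_derive.
  + repeat split; eexists; eassumption.
  + replace (Derive (fun x => g x) s) with (h s) by (symmetry; apply is_derive_unique, HdG).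
    replace (Derive (fun x => u x) s) with (- q * Rpower (s + R0) (- q - 1) * 1)
      by (symmetry; apply is_derive_unique, HdR).
    replace (Derive (fun x => v x) s) with ((p + 1) * Rpower (f s) p * g s)
      by (symmetry; apply is_derive_unique, HdF).
    unfold E1, V, u, v; field; lra.
- intros s Hs; unfold E1.
  apply Rplus_le_le_0_compat.
  + apply Rmult_le_pos; [apply Hg; lra|].
    generalize (Hh s ltac:(lra)); lra.
  + apply Rmult_le_pos.
    * apply Rmult_le_pos; [apply Rlt_le, Rdiv_lt_0_compat; lra|].
      apply Rmult_le_pos; [lra | apply Rlt_le, Rpower_gt0].
    * unfold V.
      assert (Rpower (f 0) (p + 1) <= Rpower (f s) (p + 1)); [|lra].
      apply Rle_Rpower_l; [lra|]. split; [assumption | apply Hf; lra].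
Qed.

(** Dividing the differential inequality by [f^(1+d)] leaves [f^(r-d)], at least [(A t^a)^(r-d)] as
    [d <= r]. So [f' f^(-1-d) >= K t^(m-1)]. As [d > 0], the integral of the left side is less than
    [f(s)^(-d) / d], however large [f] becomes. *)
Lemma blowup_time_bound (a b r d k A s S : R) (f g : R -> R) :
  0 < d -> d <= r -> 0 < 1 - b + a * (r - d) -> 0 < k -> 0 < A ->
  0 < s -> s <= S ->
  (forall t, s <= t <= S -> is_derive f t (g t)) ->
  (forall t, s <= t <= S -> A * Rpower t a <= f t) ->
  (forall t, s <= t <= S -> k * Rpower t (- b) * Rpower (f t) (1 + r) <= g t) ->
  k * d * Rpower A r * Rpower s (1 - b + a * r)
    * (Rpower (S / s) (1 - b + a * (r - d)) - 1) < 1 - b + a * (r - d).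
Proof.
intros Hd Hdr Hm Hk HA Hs HS Df Hf Hg.
set (m := 1 - b + a * (r - d)) in *.
assert (Hpos : forall t, s <= t <= S -> 0 < f t).
{ intros t Ht; apply Rlt_le_trans with (2 := Hf t Ht).
  apply Rmult_lt_0_compat; [assumption | apply Rpower_gt0]. }
pose (K := k * Rpower A (r - d)).
(* A primitive of [f' f^(-1-d) - K t^(m-1)]. *)
pose (G := fun t => - / d * Rpower (f t) (- d) - K / m * Rpower t m).
pose (G1 := fun t => Rpower (f t) (- d - 1) * g t - K * Rpower t (m - 1)).
assert (DG : forall t, s <= t <= S -> is_derive G t (G1 t)).
{ intros t Ht.
  assert (HdF := is_derive_Rpower_comp f (- d) t (g t) (Hpos t Ht) (Df t Ht)).
  assert (HdT := is_derive_Rpower_comp (fun x => x) m t 1 ltac:(lra) (is_derive_id t)).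
  unfold G.
  replace (G1 t) with (- / d * (- d * Rpower (f t) (- d - 1) * g t)
     - K / m * (m * Rpower t (m - 1) * 1)) by (unfold G1; field; lra).
  apply (is_derive_minus (fun x => - / d * Rpower (f x) (- d)) (fun x => K / m * Rpower x m));
    apply is_derive_scal; assumption. }
assert (HG : G s <= G S).
{ apply (le_of_derive_nonneg G G1); [assumption | | |].
  - apply derivable_continuous_pt; exists (G1 s). apply is_derive_Reals, DG; lra.
  - intros t Ht; apply DG; lra.
  - intros t Ht; unfold G1.
    assert (Ht' : s <= t <= S) by lra.
    apply Rle_trans with
      (Rpower (f t) (- d - 1) * (k * Rpower t (- b) * Rpower (f t) (1 + r))
        - K * Rpower t (m - 1)).
    2:{ apply Rplus_le_compat_r, Rmult_le_compat_l; [apply Rlt_le, Rpower_gt0 | apply Hg, Ht']. }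
    replace (Rpower (f t) (- d - 1) * (k * Rpower t (- b) * Rpower (f t) (1 + r)))
      with (k * Rpower t (- b) * Rpower (f t) (r - d)).
    2:{ replace (r - d) with ((- d - 1) + (1 + r)) by ring. rewrite Rpower_plus; ring. }
    replace (K * Rpower t (m - 1))
      with (k * Rpower t (- b) * Rpower (A * Rpower t a) (r - d)).
    2:{ rewrite <- Rpower_mult_distr by (assumption || apply Rpower_gt0).
        rewrite Rpower_mult.
        replace (m - 1) with (- b + a * (r - d)) by (unfold m; ring).
        rewrite Rpower_plus; unfold K; ring. }
    assert (Rpower (A * Rpower t a) (r - d) <= Rpower (f t) (r - d)).
    { apply Rle_Rpower_l; [lra|]. split; [|apply Hf, Ht'].
      apply Rmult_lt_0_compat; [assumption | apply Rpower_gt0]. }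
    assert (0 <= k * Rpower t (- b)).
    { apply Rmult_le_pos; [lra | apply Rlt_le, Rpower_gt0]. }
    generalize (Rmult_le_compat_l _ _ _ H0 H); lra. }
(* Dropping the positive term in [f S] removes the unknown final value and makes the inequality
   strict. *)
assert (H1 : K / m * (Rpower S m - Rpower s m) < / d * Rpower (f s) (- d)).
{ unfold G in HG.
  assert (0 < / d * Rpower (f S) (- d)).
  { apply Rmult_lt_0_compat; [apply Rinv_0_lt_compat, Hd | apply Rpower_gt0]. }
  lra. }
assert (H2 : Rpower (f s) (- d) <= Rpower A (- d) * Rpower s (- a * d)).
{ replace (- a * d) with (a * - d) by ring.
  rewrite <- Rpower_mult, Rpower_mult_distr by (assumption || apply Rpower_gt0).
  rewrite !Rpower_Ropp.
  apply Rinv_le_contravar; [apply Rpower_gt0|].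
  apply Rle_Rpower_l; [lra|]. split; [|apply Hf; lra].
  apply Rmult_lt_0_compat; [assumption | apply Rpower_gt0]. }
(* Factoring out [s^m] leaves [S] only in the ratio [S / s]. *)
assert (H3 : Rpower S m = Rpower s m * Rpower (S / s) m).
{ rewrite Rpower_mult_distr; [f_equal; field; lra | assumption |].
  apply Rdiv_lt_0_compat; lra. }
set (X := Rpower (S / s) m) in *.
assert (H4 : K / m * (Rpower s m * (X - 1)) < / d * (Rpower A (- d) * Rpower s (- a * d))).
{ apply Rle_lt_trans with (K / m * (Rpower S m - Rpower s m)).
  - rewrite H3; right; ring.
  - apply Rlt_le_trans with (1 := H1), Rmult_le_compat_l, H2.
    apply Rlt_le, Rinv_0_lt_compat, Hd. }
assert (H5 : Rpower A r = Rpower A (r - d) * Rpower A d).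
{ rewrite <- Rpower_plus; f_equal; ring. }
assert (H6 : Rpower s (1 - b + a * r) = Rpower s m * Rpower s (a * d)).
{ rewrite <- Rpower_plus; f_equal; unfold m; ring. }
assert (HAd : Rpower A (- d) * Rpower A d = 1).
{ rewrite <- Rpower_plus, Rplus_opp_l; apply Rpower_O, HA. }
assert (Hsd : Rpower s (- a * d) * Rpower s (a * d) = 1).
{ rewrite <- Rpower_plus. replace (- a * d + a * d) with 0 by ring. apply Rpower_O, Hs. }
(* This factor turns the right side into [m]; on the left the exponents add up to [A^r] and
   [s^(m + a d)], where [m + a d = 1 - b + a r]. *)
apply Rmult_lt_compat_r with (r := m * d * (Rpower A d * Rpower s (a * d))) in H4.
2:{ repeat apply Rmult_lt_0_compat; try assumption; apply Rpower_gt0. }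
replace (/ d * (Rpower A (- d) * Rpower s (- a * d)) *
     (m * d * (Rpower A d * Rpower s (a * d)))) with
  (m * (Rpower A (- d) * Rpower A d) * (Rpower s (- a * d) * Rpower s (a * d))) in H4
  by (field; lra).
rewrite HAd, Hsd in H4.
rewrite H5, H6.
replace (k * d * (Rpower A (r - d) * Rpower A d) * (Rpower s m * Rpower s (a * d)) * (X - 1))
  with (K / m * (Rpower s m * (X - 1)) * (m * d * (Rpower A d * Rpower s (a * d))))
  by (unfold K; field; lra).
lra.
Qed.

(** Here [x], [y], [z] stand for [F(0)], [F(t)], [F'(t)]. From [y >= 2 x] the subtracted power costs
    at most half of [y^(p+1)], and [t >= R0] gives [t + R0 <= 2 t]; the claim is then the square
    root of the energy bound. *)
Lemma first_order_bound (p q B R0 t x y z : R) :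
  1 < p -> 0 < q -> 0 < B -> 0 < R0 <= t -> 0 < x -> 2 * x <= y -> 0 <= z ->
  B / (p + 1) * Rpower (t + R0) (- q) * (Rpower y (p + 1) - Rpower x (p + 1)) <= z * z / 2 ->
  sqrt (B / (p + 1)) * Rpower 2 (- (q / 2)) * Rpower t (- (q / 2))
    * Rpower y (1 + (p - 1) / 2) <= z.
Proof.
intros Hp Hq HB HR Hx Hxy Hz H.
set (c := B / (p + 1)) in *.
assert (Hc : 0 < c) by (apply Rdiv_lt_0_compat; lra).
apply Rsqr_incr_0_var; [|assumption].
assert (Hy : Rpower y (p + 1) <= 2 * (Rpower y (p + 1) - Rpower x (p + 1))).
{ rewrite !Rpower_plus, !Rpower_1 by lra.
  assert (Rpower x p <= Rpower y p) by (apply Rle_Rpower_l; lra).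
  assert (Rpower x p * (2 * x) <= Rpower y p * y).
  { apply Rmult_le_compat; try lra. apply Rlt_le, Rpower_gt0. }
  lra. }
assert (Ht : Rpower 2 (- q) * Rpower t (- q) <= Rpower (t + R0) (- q)).
{ rewrite Rpower_mult_distr, !Rpower_Ropp by lra.
  apply Rinv_le_contravar; [apply Rpower_gt0|].
  apply Rle_Rpower_l; lra. }
assert (Hsq : forall u v, Rpower u v * Rpower u v = Rpower u (2 * v)).
{ intros u v; rewrite <- Rpower_plus; f_equal; ring. }
unfold Rsqr.
replace (_ * _) with ((sqrt c * sqrt c)
   * ((Rpower 2 (- (q / 2)) * Rpower 2 (- (q / 2)))
   * (Rpower t (- (q / 2)) * Rpower t (- (q / 2))))
   * (Rpower y (1 + (p - 1) / 2) * Rpower y (1 + (p - 1) / 2))) by ring.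
rewrite !Hsq, sqrt_sqrt by lra.
replace (2 * - (q / 2)) with (- q) by field.
replace (2 * (1 + (p - 1) / 2)) with (p + 1) by field.
apply Rle_trans with
  (c * Rpower (t + R0) (- q) * (2 * (Rpower y (p + 1) - Rpower x (p + 1)))); [|lra].
assert (H2 := Rpower_gt0 2 (- q)). assert (H3 := Rpower_gt0 t (- q)).
apply Rmult_le_compat; try assumption.
- apply Rmult_le_pos; [lra|]. apply Rmult_le_pos; lra.
- apply Rlt_le, Rpower_gt0.
- apply Rmult_le_compat_l; lra.
Qed.

(** * From limits along [[0, T)] to two-sided limits *)

Lemma is_derive_of_D_in (D : R -> Prop) (f f1 : R -> R) (t : R) :
  locally t D -> D_in f f1 D t -> is_derive f t (f1 t).
Proof.
intros [d1 Hd1] HD.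
apply is_derive_Reals; intros eps Heps.
destruct (HD eps Heps) as [d2 [Hd2 H]].
assert (Hmin : 0 < Rmin d1 d2) by (apply Rmin_pos; [apply cond_pos | exact Hd2]).
exists (mkposreal _ Hmin); simpl; intros h Hh0 Hh.
assert (Hh1 := Rmin_l d1 d2). assert (Hh2 := Rmin_r d1 d2).
generalize (H (t + h)); simpl; unfold Rdist.
replace (t + h - t) with h by ring.
intros Hlim; apply Hlim. repeat split.
- apply Hd1. change (Rabs (t + h - t) < d1).
  replace (t + h - t) with h by ring. lra.
- lra.
- lra.
Qed.

(** Precomposing with [Rmax 0] extends [f] to negative times by the constant [f 0], which turns
    right continuity at 0 into continuity. *)
Lemma continuity_pt_extend0 (T : Rbar) (f : R -> R) :
  Rbar_lt 0 T -> continue_in f (Ico0 T) 0 -> continuity_pt (fun t => f (Rmax 0 t)) 0.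
Proof.
intros HT Hc eps Heps.
assert (exists d0, 0 < d0 /\ forall t, 0 <= t < d0 -> Ico0 T t) as [d0 [Hd0 HI]].
{ destruct T as [T | |]; simpl in HT.
  - exists T; split; [assumption|]. intros t Ht; split; simpl; lra.
  - exists 1; split; [lra|]. intros t Ht; split; [lra | exact I].
  - contradiction. }
destruct (Hc eps Heps) as [d2 [Hd2 H]].
exists (Rmin d0 d2); split; [apply Rmin_pos; assumption|].
simpl in *; unfold Rdist in *; intros t [_ Ht].
rewrite (Rmax_left 0 0) by lra.
assert (Hh1 := Rmin_l d0 d2). assert (Hh2 := Rmin_r d0 d2).
destruct (Rle_lt_dec t 0) as [Ht0 | Ht0].
- rewrite Rmax_left by assumption. rewrite Rminus_diag, Rabs_R0; assumption.
- rewrite Rmax_right by lra.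
  rewrite Rminus_0_r, Rabs_pos_eq in Ht by lra.
  apply H; split; [split; [apply HI | ]; lra|].
  rewrite Rminus_0_r, Rabs_pos_eq; lra.
Qed.

Lemma is_derive_extend0 (f : R -> R) (t df : R) :
  0 < t -> is_derive f t df -> is_derive (fun s => f (Rmax 0 s)) t df.
Proof.
intros Ht; apply is_derive_ext_loc.
exists (mkposreal t Ht); intros s Hs; change (Rabs (s - t) < t) in Hs.
apply Rabs_def2 in Hs. rewrite Rmax_right; [reflexivity | lra].
Qed.

Lemma locally_Ico0 (T : Rbar) (t : R) :
  0 < t -> Rbar_lt t T -> locally t (Ico0 T).
Proof.
intros Ht HT.
apply filter_and.
- apply filter_imp with (fun s => 0 < s); [intros s; lra|].
  apply (open_gt 0 t Ht).
- apply (open_Rbar_lt T t HT).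
Qed.

(** * Choice of the constants and contradiction *)

Theorem lemma2p2 (p a q B : R)
  (hp : 1 < p) (ha : 0 < a) (hq : 0 < q) (hB : 0 < B) :
  let M := (p - 1) / 2 * a - q / 2 + 1 in
  0 < M ->
  exists C0 : R, 0 < C0 /\
    forall (A R0 T0 : R) (T : Rbar) (F F' F'' : R -> R) (t0 : R),
      0 < A -> 0 < R0 -> 0 < T0 -> Rbar_lt 0 T ->
      C2_on (Ico0 T) F F' F'' ->
      (forall t : R, T0 <= t -> Rbar_lt t T -> F t >= A * Rpower t a) ->
      (forall t : R, 0 <= t -> Rbar_lt t T ->
         F'' t >= B * Rpower (t + R0) (- q) * abs_pow (F t) p) ->
      F 0 > 0 ->
      F' 0 = 0 ->
      0 < t0 -> Rbar_lt t0 T ->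
      F t0 >= 2 * F 0 ->
      let T2 := Rmax T0 (Rmax t0 R0) in
      T2 >= C0 * Rpower A (- (p - 1) / (2 * M)) ->
      Rbar_lt T (Rpower 2 (2 / M) * T2).
Proof.
intros M HM.
set (r := (p - 1) / 2) in *.
(* The two bounds in the minimum give [d <= r] and [a d <= M / 2]; the latter keeps [m = M - a d]
   positive. *)
set (d := Rmin r (M / (2 * a))).
assert (Hr : 0 < r) by (unfold r; lra).
assert (Hd : 0 < d).
{ apply Rmin_pos; [assumption | apply Rdiv_lt_0_compat; lra]. }
assert (Hdr : d <= r) by apply Rmin_l.
assert (Hda : a * d <= M / 2).
{ replace (M / 2) with (a * (M / (2 * a))) by (field; lra).
  apply Rmult_le_compat_l; [lra | apply Rmin_r]. }
set (m := 1 - q / 2 + a * (r - d)).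
assert (Hm : 0 < m) by (unfold m, M in *; lra).
set (lam := Rpower 2 (2 / M)).
assert (Hlam : 1 < lam).
{ rewrite <- (Rpower_O 2) by lra. apply Rpower_lt; [lra|]. apply Rdiv_lt_0_compat; lra. }
(* Any value strictly between 1 and [lam] would do: if [T >= lam T2], the closed interval up to
   [mu T2] lies inside [[0, T)]. *)
set (mu := (1 + lam) / 2).
assert (Hmu : 1 < mu < lam) by (unfold mu; lra).
set (k := sqrt (B / (p + 1)) * Rpower 2 (- (q / 2))).
assert (Hk : 0 < k).
{ apply Rmult_lt_0_compat; [|apply Rpower_gt0].
  apply sqrt_lt_R0, Rdiv_lt_0_compat; lra. }
assert (Hmum : 0 < Rpower mu m - 1).
{ rewrite <- (Rpower_O mu) by lra.
  apply Rlt_0_minus, Rpower_lt; lra. }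
set (W := k * d * (Rpower mu m - 1)).
assert (HW : 0 < W) by (apply Rmult_lt_0_compat, Hmum; apply Rmult_lt_0_compat; assumption).
(* Chosen so that the hypothesis on [T2], raised to the power [M], reads
   [T2^M >= (m / W) A^(-r)]. *)
exists (Rpower (m / W) (/ M)); split; [apply Rpower_gt0|].
intros A R0 T0 T F F' F'' t0 HA HR0 HT0 HT HC2 HFA HF2 HF0 HF10 Ht0 Ht0T HFt0 T2 HT2.
apply Rbar_not_le_lt; intros HlamT.
assert (HT2a : T0 <= T2) by apply Rmax_l.
assert (HT2b : t0 <= T2) by (eapply Rle_trans; [apply Rmax_l | apply Rmax_r]).
assert (HT2c : R0 <= T2) by (eapply Rle_trans; [apply Rmax_r | apply Rmax_r]).
set (S := mu * T2).
assert (HST2 : T2 <= S).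
{ rewrite <- (Rmult_1_l T2) at 1. apply Rmult_le_compat_r; lra. }
assert (HST : forall t, t <= S -> Rbar_lt t T).
{ intros t Ht; apply Rbar_lt_le_trans with (2 := HlamT); simpl.
  apply Rle_lt_trans with (1 := Ht). apply Rmult_lt_compat_r; lra. }
pose (f := fun t => F (Rmax 0 t)). pose (g := fun t => F' (Rmax 0 t)).
assert (Ef : forall t, 0 <= t -> f t = F t).
{ intros t Ht; unfold f; rewrite Rmax_right; [reflexivity | assumption]. }
assert (Eg : forall t, 0 <= t -> g t = F' t).
{ intros t Ht; unfold g; rewrite Rmax_right; [reflexivity | assumption]. }
destruct (HC2 0) as [HD0 [HD1 _]]; [split; [lra | exact HT]|].
assert (Cf : continuity_pt f 0).
{ apply continuity_pt_extend0 with (1 := HT). eapply cont_deriv, HD0. }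
assert (Cg : continuity_pt g 0).
{ apply continuity_pt_extend0 with (1 := HT). eapply cont_deriv, HD1. }
assert (Df : forall t, 0 < t <= S -> is_derive f t (g t)).
{ intros t Ht; rewrite Eg by lra. apply is_derive_extend0; [lra|].
  assert (HtT := HST t (proj2 Ht)).
  apply is_derive_of_D_in with (Ico0 T); [apply locally_Ico0; [lra | exact HtT]|].
  apply HC2; split; [lra | exact HtT]. }
assert (Dg : forall t, 0 < t <= S -> is_derive g t (F'' t)).
{ intros t Ht; apply is_derive_extend0; [lra|].
  assert (HtT := HST t (proj2 Ht)).
  apply is_derive_of_D_in with (Ico0 T); [apply locally_Ico0; [lra | exact HtT]|].
  apply HC2; split; [lra | exact HtT]. }
(* [F''] is nonnegative by its lower bound, whatever the sign of [F], so [F'] grows from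
   [F'(0) = 0]. *)
assert (Hg : forall t, 0 <= t <= S -> 0 <= g t).
{ intros t Ht. rewrite <- HF10, <- (Eg 0) by lra.
  apply (le_of_derive_nonneg g F''); [lra | exact Cg | |].
  - intros s Hs; apply Dg; lra.
  - intros s Hs. apply Rle_trans with (2 := Rge_le _ _ (HF2 s ltac:(lra) (HST s ltac:(lra)))).
    apply Rmult_le_pos; [apply Rmult_le_pos; [lra | apply Rlt_le, Rpower_gt0]|].
    unfold abs_pow; destruct Req_dec_T; [lra | apply Rlt_le, Rpower_gt0]. }
assert (Hmono : forall s t, 0 <= s -> s <= t -> t <= S -> f s <= f t).
{ intros s t Hs Hst HtS.
  apply (le_of_derive_nonneg f g); [assumption | | |].
  - destruct (Req_dec s 0) as [-> | Hs0]; [exact Cf|].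
    apply derivable_continuous_pt; exists (g s). apply is_derive_Reals, Df; lra.
  - intros u Hu; apply Df; lra.
  - intros u Hu; apply Hg; lra. }
assert (Hf0 : 0 < f 0) by (rewrite Ef; lra).
assert (Hg0 : g 0 = 0) by (rewrite Eg; lra).
assert (HE : forall t, 0 <= t <= S ->
  B / (p + 1) * Rpower (t + R0) (- q) * (Rpower (f t) (p + 1) - Rpower (f 0) (p + 1))
    <= g t * g t / 2).
{ apply (energy_bound p q B R0 S f g F''); try assumption.
  - intros t Ht; apply Hg; lra.
  - intros t Ht; apply Hmono; lra.
  - intros t Ht.
    assert (Hft : f 0 <= f t) by (apply Hmono; lra).
    assert (H := HF2 t ltac:(lra) (HST t ltac:(lra))).
    rewrite <- (Ef t) in H by lra.
    (* Monotonicity keeps [F] at least [F(0) > 0], so [abs_pow] is the ordinary power here. *)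
    unfold abs_pow in H; destruct Req_dec_T; [lra|].
    rewrite Rabs_pos_eq in H by lra. lra. }
assert (HB1 := blowup_time_bound a (q / 2) r d k A T2 S f g Hd Hdr Hm Hk HA
  ltac:(lra) HST2).
fold m in HB1.
replace (S / T2) with mu in HB1 by (unfold S; field; lra).
replace (1 - q / 2 + a * r) with M in HB1 by (unfold M; ring).
(* [HB1] will give the strict reverse inequality, so this bound, to be drawn from the size of [T2],
   is contradictory. *)
enough (HAT : m <= W * (Rpower A r * Rpower T2 M)).
{ apply (Rlt_irrefl m), Rle_lt_trans with (1 := HAT).
  replace (W * (Rpower A r * Rpower T2 M))
    with (k * d * Rpower A r * Rpower T2 M * (Rpower mu m - 1)) by (unfold W; ring).
  apply HB1.
  - intros t Ht; apply Df; lra.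
  - intros t Ht; rewrite Ef by lra. apply Rge_le, HFA; [lra | apply HST; lra].
  - intros t Ht.
    apply (first_order_bound p q B R0 t (f 0)); try assumption.
    + lra.
    (* The doubling at [t0] persists at all later times, in particular from [T2] on. *)
    + apply Rle_trans with (f t0); [rewrite !Ef; lra | apply Hmono; lra].
    + apply Hg; lra.
    + apply HE; lra. }
apply Rge_le in HT2.
assert (HC0 : 0 < Rpower (m / W) (/ M) * Rpower A (- (p - 1) / (2 * M)))
  by (apply Rmult_lt_0_compat; apply Rpower_gt0).
assert (HTM := Rle_Rpower_l _ _ M (Rlt_le _ _ HM) (conj HC0 HT2)).
rewrite <- Rpower_mult_distr, !Rpower_mult in HTM by apply Rpower_gt0.
replace (/ M * M) with 1 in HTM by (field; lra).
replace (- (p - 1) / (2 * M) * M) with (- r) in HTM by (unfold r; field; lra).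
rewrite Rpower_1 in HTM by (apply Rdiv_lt_0_compat; assumption).
apply Rle_trans with (W * (Rpower A r * (m / W * Rpower A (- r)))).
- rewrite Rpower_Ropp; right; field.
  split; apply Rgt_not_eq; [apply Rpower_gt0 | assumption].
- apply Rmult_le_compat_l; [lra|].
  apply Rmult_le_compat_l; [apply Rlt_le, Rpower_gt0 | exact HTM].
Qed.
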